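(* Let $X$ be a non-empty set, let $\mathcal{F}$ be a $C^{\ast}$-subalgebra of $\ell^{\infty}(X)$ containing the constant functions, let $\delta X$ be the space of all $\mathcal{F}$-ultrafilters on $X$, and let $e:X\to\delta X$ be the evaluation mapping. Then the space $\delta X$ is a compact Hausdorff space and $e(X)$ is dense in $\delta X$.
   Context: $\ell^{\infty}(X)$ is the $C^{\ast}$-algebra of all bounded complex-valued functions on $X$ (pointwise operations, supremum norm, involution given by complex conjugation). A filter on $X$ is a non-empty family of subsets of $X$ closed under finite intersections and under supersets and not containing $\emptyset$. An $\mathcal{F}$-family on $X$ is a non-empty set $\mathcal{A}$ of non-empty subsets of $X$ such that for every $A\in\mathcal{A}$ with $A\neq X$ there exist $B\in\mathcal{A}$ and $f\in\mathcal{F}$ with $f(B)=\{0\}$ and $f(X\setminus A)=\{1\}$. An $\mathcal{F}$-filter is a filter on $X$ which is also an $\mathcal{F}$-family; an $\mathcal{F}$-ultrafilter is an $\mathcal{F}$-filter not properly contained in any other $\mathcal{F}$-filter on $X$. $\delta X$ is the set of all $\mathcal{F}$-ultrafilters on $X$; for $A\subseteq X$ put $\widehat{A}=\{p\in\delta X: A\in p\}$, and give $\delta X$ the topology having $\{\widehat{A}:A\subseteq X\}$ as a base. $\tau(\mathcal{F})$ is the weakest topology on $X$ making every $f\in\mathcal{F}$ continuous, and $\mathcal{N}_{\mathcal{F}}(x)$ is the neighborhood filter of $x$ in $(X,\tau(\mathcal{F}))$; it is an $\mathcal{F}$-ultrafilter. The evaluation mapping $e:X\to\delta X$ is $e(x)=\mathcal{N}_{\mathcal{F}}(x)$.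 *)

(* Defs.v *)
From HB Require Import structures.
From mathcomp Require Import all_boot all_order all_algebra.
From mathcomp Require Import all_classical all_reals all_analysis.
From mathcomp Require Import complex.
From mathcomp Require Import lra.

Set Implicit Arguments.
Unset Strict Implicit.
Unset Printing Implicit Defensive.

Import Order.TTheory GRing.Theory Num.Theory.
Import numFieldNormedType.Exports.
Import ComplexField.

Local Open Scope classical_set_scope.
Local Open Scope ring_scope.
Local Open Scope complex_scope.

Definition linfty (R : realType) (X : Type) : set (X -> R[i]) :=
  [set f | has_ubound (range (fun x => Normc.normc (f x)))].

(* For f in [linfty], the set of values below is bounded above, so that [sup]
   is a genuine supremum. *)
Definition supnorm (R : realType) (X : Type) (f : X -> R[i]) : R :=
  sup (range (fun x => Normc.normc (f x))).

Record Cstar_subalgebra (R : realType) (X : Type) (F : set (X -> R[i])) : Prop := {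
  Cstar_linfty : F `<=` @linfty R X ;
  Cstar0 : F (fun=> 0) ;
  CstarD : forall f g, F f -> F g -> F (fun x => f x + g x) ;
  CstarZ : forall (c : R[i]) f, F f -> F (fun x => c * f x) ;
  CstarM : forall f g, F f -> F g -> F (fun x => f x * g x) ;
  CstarJ : forall f, F f -> F (fun x => (f x)^*) ;
  Cstar_closed : forall f, linfty f ->
    (forall e : R, 0 < e -> exists2 g, F g & supnorm (fun x => f x - g x) < e) ->
    F f }.

Definition contains_constants (R : realType) (X : Type) (F : set (X -> R[i])) :=
  forall c : R[i], F (fun=> c).

Section Fultrafilters.
Variables (R : realType) (X : Type) (F : set (X -> R[i])).

Definition Ffamily (A : set_system X) : Prop :=
  [/\ A !=set0,
      forall S, A S -> S !=set0 &
      forall S, A S -> S <> setT ->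
        exists B f, [/\ A B, F f, f @` B = [set 0] & f @` (~` S) = [set 1]]].

Definition Ffilter (p : set_system X) : Prop := ProperFilter p /\ Ffamily p.

Definition Fultrafilter (p : set_system X) : Prop :=
  Ffilter p /\ forall q : set_system X, Ffilter q -> ~ p `<` q.

Definition delta : Type := {p : set_system X | Fultrafilter p}.

HB.instance Definition _ := gen_eqMixin delta.
HB.instance Definition _ := gen_choiceMixin delta.

Definition hat (A : set X) : set delta := [set p | sval p A].

Lemma hatT : hat setT = setT.
Proof.
apply/seteqP; split=> // -[p pU] _; rewrite /hat /=.
by case: pU => -[pF _] _; exact: filterT.
Qed.

Lemma hatI (A B : set X) : hat (A `&` B) = hat A `&` hat B.
Proof.
apply/seteqP; split=> -[p pU]; rewrite /hat /=; case: (pU) => -[pF _] _.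
  by move=> pAB; split; apply: filterS pAB => x [].
by case; exact: filterI.
Qed.

Lemma hat_cover : \bigcup_(A in [set: set X]) hat A = setT.
Proof. by apply/seteqP; split=> // p _; exists setT => //; rewrite hatT. Qed.

Lemma hat_join (A B : set X) (p : delta) : [set: set X] A -> [set: set X] B ->
  hat A p -> hat B p ->
  exists C, [/\ [set: set X] C, hat C p & hat C `<=` hat A `&` hat B].
Proof. by move=> _ _ pA pB; exists (A `&` B); rewrite hatI; split. Qed.

HB.instance Definition _ :=
  @isBaseTopological.Build delta (set X) setT hat hat_cover hat_join.

End Fultrafilters.

(* The supremum of the initial topologies of the members of F, where R[i]^o
   carries the usual topology of the complex numbers. *)
Definition tau (R : realType) (X : choiceType) (F : set (X -> R[i])) : topologicalType :=
  sup_topology (fun f : {f : X -> R[i] | F f} =>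
    Topological.class (initial_topology (sval f : X -> R[i]^o))).

Definition Fnbhs (R : realType) (X : choiceType) (F : set (X -> R[i])) (x : X) :
  set_system X := nbhs (x : tau F).

(* Real-valued functions are identified with complex-valued ones. *)
Definition real_mem (R : realType) (X : Type) (F : set (X -> R[i])) (u : X -> R) :=
  F (fun x => (u x)%:C).

Section evaluation.
Variables (R : realType) (X : choiceType) (F : set (X -> R[i])).
Hypotheses (FA : Cstar_subalgebra F) (F1 : contains_constants F).

Local Notation FR := (real_mem F).

Lemma real_mem_cst (c : R) : FR (fun=> c). Proof. exact: F1. Qed.

Lemma real_memD u v : FR u -> FR v -> FR (fun x => u x + v x).
Proof.
move=> Fu Fv; have := CstarD FA Fu Fv; rewrite /real_mem.
by congr F; apply/funext => x; rewrite rmorphD.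
Qed.

Lemma real_memM u v : FR u -> FR v -> FR (fun x => u x * v x).
Proof.
move=> Fu Fv; have := CstarM FA Fu Fv; rewrite /real_mem.
by congr F; apply/funext => x; rewrite rmorphM.
Qed.

Lemma real_memZ c u : FR u -> FR (fun x => c * u x).
Proof. by move=> Fu; apply: real_memM => //; exact: real_mem_cst. Qed.

Lemma normc_real (r : R) : Normc.normc r%:C = `|r|.
Proof. by rewrite /Normc.normc /= expr0n /= addr0 sqrtr_sqr. Qed.

Lemma real_mem_bounded u : FR u -> exists2 M : R, 0 < M & forall x, `|u x| <= M.
Proof.
move=> /(Cstar_linfty FA)[M uM]; exists (Num.max 1 M).
  by rewrite lt_max ltr01.
move=> x; rewrite le_max; apply/orP; right; apply: uM.
by exists x => //; rewrite normc_real.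
Qed.

Lemma real_mem_closed u : (forall e : R, 0 < e -> exists2 v, FR v & forall x, `|u x - v x| <= e) ->
  FR u.
Proof.
move=> uF; apply: (Cstar_closed FA).
  have [v Fv uv] := uF 1 ltr01; have [M _ vM] := real_mem_bounded Fv.
  exists (1 + M) => _ [x _ <-]; rewrite normc_real.
  rewrite -(subrK (v x) (u x)); apply: le_trans (ler_normD _ _) _.
  exact: lerD.
move=> e e0; have e20 : 0 < e / 2 by rewrite divr_gt0.
have [v Fv uv] := uF _ e20; exists (fun x => (v x)%:C) => //.
apply: (@le_lt_trans _ _ (e / 2)); last by rewrite ltr_pdivrMr // mulr_natr mulr2n ltrDl.
have [[x0 _]|X0] := pselect (exists x : X, True); last first.
  rewrite /supnorm [X in sup X](_ : _ = set0) ?sup0; first exact: ltW.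
  by apply/seteqP; split=> // z [x _ _]; apply: X0; exists x.
apply: ge_sup; first by eexists; exists x0.
by move=> _ [x _ <-]; rewrite -rmorphB normc_real.
Qed.

(* The iteration p := p + (t ^ 2 - p ^ 2) / 2 started at 0 converges to `|t|
   uniformly in t in [-1, 1]. *)
Definition abs_iter (t : R) n := iter n (fun p : R => p + (t ^+ 2 - p ^+ 2) / 2) 0.

Lemma abs_iterP (t : R) n : `|t| <= 1 -> 0 <= abs_iter t n <= `|t| /\ `|t| - abs_iter t n <= 2 / n.+2%:R.
Proof.
move=> t1; have t0 := normr_ge0 t.
elim: n => [|n [/andP[p0 pt] IH]].
  by rewrite /abs_iter /= lexx t0 divff // subr0.
rewrite /abs_iter iterS -/(abs_iter t n) -[t ^+ 2]real_normK ?num_real //.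
move: t0 t1 p0 pt IH; set a := `|t|; set p := abs_iter t n => a0 a1 p0 pa IH.
have m0 : 0 < n.+2%:R :> R by rewrite ltr0n.
split; first by apply/andP; split; nra.
set c := 2 / n.+2%:R in IH.
have c1 : c <= 1 by rewrite ler_pdivrMr // mul1r ler_nat.
apply: (@le_trans _ _ (c * (1 - c / 2))).
  have : (a - p) * (1 - (a - p) / 2) <= c * (1 - c / 2) by nra.
  apply: le_trans; nra.
have m1 : 0 < n.+3%:R :> R by rewrite ltr0n.
rewrite ler_pdivlMr //.
have cm : c * n.+2%:R = 2 by rewrite /c divfK // gt_eqF.
have -> : n.+3%:R = n.+2%:R + 1 :> R by rewrite [in LHS]mulrSr.
have : 0 < c by rewrite /c divr_gt0.
by nra.
Qed.

Lemma real_mem_abs1 u : FR u -> (forall x, `|u x| <= 1) -> FR (fun x => `|u x|).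
Proof.
move=> Fu u1; apply: real_mem_closed => e e0.
pose n := Num.truncn (2 / e).
exists (fun x => abs_iter (u x) n).
  rewrite /abs_iter; elim: n => [|n IH] /=; first exact: real_mem_cst.
  have := real_memD IH (real_memZ 2^-1 (real_memD (real_memM Fu Fu) (real_memZ (-1) (real_memM IH IH)))).
  congr (real_mem _); apply/funext => x; rewrite mulN1r -!expr2.
  by congr (_ + _); rewrite mulrC.
move=> x; have [/andP[p0 pu] d] := abs_iterP n (u1 x).
rewrite ger0_norm ?subr_ge0 //; apply: le_trans d _.
rewrite ler_pdivrMr ?ltr0n // mulrC -ler_pdivrMr //.
apply: ltW; apply: lt_trans (truncnS_gt _) _.
by rewrite ltr_nat.
Qed.

Lemma real_mem_abs u : FR u -> FR (fun x => `|u x|).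
Proof.
move=> Fu; have [M M0 uM] := real_mem_bounded Fu.
have : FR (fun x => M * `|M^-1 * u x|).
  apply: real_memZ; apply: real_mem_abs1; first exact: real_memZ.
  by move=> x; rewrite normrM gtr0_norm ?invr_gt0 // mulrC ler_pdivrMr // mul1r.
congr (real_mem _); apply/funext => x.
by rewrite normrM gtr0_norm ?invr_gt0 // mulVKf // gt_eqF.
Qed.

Lemma real_mem_dist f (c : R[i]) : F f -> FR (fun y => Normc.normc (f y - c) ^+ 2).
Proof.
move=> Ff; have Fg := CstarD FA Ff (F1 (- c)).
have := CstarM FA Fg (CstarJ FA Fg); rewrite /real_mem.
by congr F; apply/funext => x; rewrite -sqr_normc rmorphXn.
Qed.

Lemma tau_continuous f : F f -> continuous (f : tau F -> R[i]^o).
Proof.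
move=> Ff x A fA.
have /cvg_sup /(_ (exist _ f Ff)) : (nbhs (x : tau F)) --> (x : tau F) by [].
by apply; exact: (@initial_continuous _ _ (f : X -> R[i]^o) x A fA).
Qed.

Lemma FnbhsP x A : Fnbhs F x A <->
  exists2 u, FR u & [/\ u x = 0, forall y, 0 <= u y & forall y, ~ A y -> 1 <= u y].
Proof.
split; last first.
  move=> [u Fu [ux u0 u1]].
  have /cvgrPdist_lt /(_ 1 ltr01) := tau_continuous Fu (x := x).
  apply: filterS => y; rewrite ux sub0r normrN => uy.
  apply: contrapT => /u1; move: uy.
  rewrite -[`|_|]/((Normc.normc _)%:C) normc_real ger0_norm // ltcR.
  by move=> /lt_le_trans /[apply]; rewrite ltxx.
pose G : set_system X := [set A | exists2 u, FR u &
  [/\ u x = 0, forall y, 0 <= u y & forall y, ~ A y -> 1 <= u y]].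
have FG : Filter G.
  split.
  - by exists (fun=> 0); [exact: real_mem_cst|split=> // y []].
  - move=> P Q [u Fu [ux u0 u1]] [v Fv [vx v0 v1]].
    exists (fun x => u x + v x); [exact: real_memD|split].
    + by rewrite ux vx addr0.
    + by move=> y; rewrite addr_ge0.
    + move=> y PQ; have [/u1 h|Py] := pselect (~ P y).
        by rewrite -[1]addr0; exact: lerD.
      have [/v1 h|Qy] := pselect (~ Q y).
        by rewrite -[1]add0r; exact: lerD.
      by exfalso; apply: PQ; split; apply: contrapT.
  - move=> P Q PQ [u Fu [ux u0 u1]]; exists u => //; split=> // y Qy.
    by apply: u1 => /PQ.
suff : G --> (x : tau F) by apply.
apply/cvg_sup => -[f Ff] B /=.
rewrite /= (@nbhsE (initial_topology (f : X -> R[i]^o))).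
move=> [_ [[V Vop <-] /= Vfx VB]].
have : nbhs (f x : R[i]^o) V by exact: open_nbhs_nbhs.
rewrite -nbhs_ballE => -[[e e'] /=]; rewrite ltcE /= => /andP[/eqP e'0 e0] eV.
exists (fun y => e^-1 ^+ 2 * Normc.normc (f y - f x) ^+ 2).
  by apply: real_memZ; exact: real_mem_dist.
split.
- by rewrite subrr Normc.normc0 expr0n /= mulr0.
- by move=> y; rewrite mulr_ge0 // sqr_ge0.
- move=> y By; rewrite -exprMn -[1](expr1n _ 2).
  have n0 : 0 <= Normc.normc (f y - f x) by case: (f y - f x) => a b; exact: sqrtr_ge0.
  rewrite lerXn2r ?nnegrE ?mulr_ge0 ?invr_ge0 ?(ltW e0) //.
  rewrite mulrC ler_pdivlMr // mul1r leNgt; apply/negP => lt.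
  apply: By; apply: VB; apply: eV; rewrite -ball_normE /ball_ /= distrC.
  by rewrite -[`|_|]/((Normc.normc _)%:C) ltcE /= e'0 eqxx lt.
Qed.

Lemma Fnbhs_proper x : ProperFilter (Fnbhs F x).
Proof. exact: (@nbhs_pfilter (tau F)). Qed.

Lemma Fnbhs_Ffilter x : Ffilter F (Fnbhs F x).
Proof.
have PF := Fnbhs_proper x; split=> //; split.
- by exists setT; exact: filterT.
- by move=> A NA; exact: (@filter_ex _ _ PF).
move=> A /FnbhsP[u Fu [ux u0 u1]] AT.
pose w y := 2 * u y - 1.
pose w' y := (w y + `|w y|) / 2.
pose h y := (1 + w' y - `|1 - w' y|) / 2.
have Fw : FR w by apply: real_memD; [exact: real_memZ|exact: real_mem_cst].
have Fw' : FR w'.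
  rewrite /w'; have := real_memZ 2^-1 (real_memD Fw (real_mem_abs Fw)).
  by congr (real_mem _); apply/funext => y; rewrite mulrC.
have Fh : FR h.
  have F1w : FR (fun y => 1 - w' y).
    have := real_memD (real_mem_cst 1) (real_memZ (-1) Fw').
    by congr (real_mem _); apply/funext => y; rewrite mulN1r.
  have := real_memZ 2^-1 (real_memD (real_memD (real_mem_cst 1) Fw') (real_memZ (-1) (real_mem_abs F1w))).
  by congr (real_mem _); apply/funext => y; rewrite mulN1r mulrC.
have h0 y : u y <= 1 / 2 -> h y = 0.
  move=> uy; have wy : w y <= 0 by rewrite /w; lra.
  have w'y : w' y = 0 by rewrite /w' ler0_norm // subrr mul0r.
  by rewrite /h w'y subr0 addr0 normr1 subrr mul0r.
have h1 y : ~ A y -> h y = 1.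
  move=> /u1 uy; have wy : 1 <= w y by rewrite /w; lra.
  have w'y : w' y = w y by rewrite /w' ger0_norm; lra.
  by rewrite /h w'y ler0_norm; lra.
exists [set y | u y <= 1 / 2], (fun y => (h y)%:C); split=> //.
- apply/FnbhsP; exists (fun y => 2 * u y); first exact: real_memZ.
  split=> [|y|y /= /negP]; first by rewrite ux mulr0.
  + by rewrite mulr_ge0.
  + by rewrite -ltNge => ?; lra.
- apply/seteqP; split=> [_ [y /= /h0 -> <-]//|_ ->].
  by exists x => /=; [rewrite ux; lra|rewrite h0 // ux; lra].
- apply/seteqP; split=> [_ [y /= /h1 -> <-]//|_ ->].
  have [y Ay] : exists y, ~ A y.
    by apply: contrapT => /forallNP nA; apply: AT; apply/seteqP; split=> // y _; apply: contrapT => /nA.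
  by exists y => //; rewrite h1.
Qed.

Lemma Fnbhs_Fultrafilter x : Fultrafilter F (Fnbhs F x).
Proof.
split; first exact: Fnbhs_Ffilter.
move=> q [qF [_ _ qfam]] [Nq]; apply => A qA.
have [->|AT] := pselect (A = setT); first exact: (@filterT _ _ (Fnbhs_proper x)).
have [B [f [qB Ff fB fA]]] := qfam _ qA AT.
have fB0 y : B y -> f y = 0.
  by move=> By; have : [set 0] (f y) by rewrite -fB; exists y.
have fA1 y : ~ A y -> f y = 1.
  by move=> Ay; have : [set 1] (f y) by rewrite -fA; exists y.
have fcx := tau_continuous Ff (x := x).
have fx : f x = 0.
  apply: contrapT => /eqP fx; have nfx : 0 < `|f x| by rewrite normr_gt0.
  have /cvgrPdist_lt /(_ _ nfx) /Nq qf := fcx.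
  have [y [/= + /fB0 fy]] := @filter_ex _ _ qF _ (filterI qf qB).
  by rewrite fy subr0 ltxx.
have /cvgrPdist_lt /(_ _ ltr01) := fcx; apply: filterS => y.
rewrite fx sub0r normrN => fy; apply: contrapT => /fA1 fy1.
by move: fy; rewrite fy1 normr1 ltxx.
Qed.

Definition evaluation (x : X) : delta F := exist _ (Fnbhs F x) (Fnbhs_Fultrafilter x).

End evaluation.

(* Main.v *)
Require Import Defs.
From mathcomp Require Import all_boot all_order all_algebra.
From mathcomp Require Import all_classical all_reals all_analysis.
From mathcomp Require Import complex.
From mathcomp Require Import lra.

(** The algebra F enters the proof only through the relation [well_inside B A]
  (some real-valued u in F is nonpositive on B and at least 1 off A).  It is a
  proximity in the sense of Efremovich: it is monotone, stable under finite
  intersections ([well_insideI], which needs truncations, hence absolute values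
  of members of F), reversed by complements ([well_insideC]) and interpolative
  ([well_inside_interp]).  F-filters are exactly the proper filters in which
  every member has some member well inside it ([FfilterP]), that is, the
  round filters of this proximity, and the space of F-ultrafilters is its
  Smirnov compactification, except that F need not separate points.

  Everything rests on one dichotomy ([Fultrafilter_dichotomy]): if B is well
  inside A, an F-ultrafilter contains A or the complement of B.  Otherwise B
  meets every member of p, and adjoining to p all sets in which B is well
  inside gives an F-filter that contains A, against maximality.

  Hausdorff: if A is in p but not in q, take B in p well inside A; by the
  dichotomy q contains the complement of B, and the basic open sets of B and of
  its complement are disjoint.  Compact: given an ultrafilter U on the space,
  the sets A that have well inside them some B with [U (hat B)] form an
  F-filter.  The dichotomy says that the basic open sets of A and ~` B cover
  the space, so U contains one of them; this makes that F-filter maximal, and U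
  converges to it.  Dense: a member of an F-filter has some B well inside
  it, so it is a neighborhood of each point of B. *)

Set Implicit Arguments.
Unset Strict Implicit.
Unset Printing Implicit Defensive.

Import Order.TTheory GRing.Theory Num.Theory.
Import numFieldNormedType.Exports.

Local Open Scope classical_set_scope.
Local Open Scope ring_scope.
Local Open Scope complex_scope.

Section proximity.
Variables (R : realType) (X : choiceType) (F : set (X -> R[i])).
Hypotheses (FA : Cstar_subalgebra F) (F1 : contains_constants F).

(** Inequalities rather than the values 0 and 1 spare truncations: affine
    changes of u are then enough for interpolation and complements. *)
Definition well_inside (B A : set X) := exists2 u : X -> R, real_mem F u &
  (forall x, B x -> u x <= 0) /\ (forall x, ~ A x -> 1 <= u x).

Local Notation "B \inside A" := (well_inside B A) (at level 70).

Lemma well_inside_sub B A : B \inside A -> B `<=` A.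
Proof.
move=> [u _ [u0 u1]] x /u0 ux; apply: contrapT => /u1 /le_trans/(_ ux).
by rewrite ler10.
Qed.

Lemma well_insideS B' B A A' : B' `<=` B -> A `<=` A' -> B \inside A -> B' \inside A'.
Proof.
move=> BB AA [u Fu [u0 u1]]; exists u => //; split=> x.
  by move=> /BB/u0.
by move=> nA; apply: u1 => /AA.
Qed.

Lemma well_insideT B : B \inside setT.
Proof.
by exists (fun=> 0); [exact: (real_mem_cst F1)|split=> // x; case].
Qed.

Lemma real_mem_affine (a b : R) u :
  real_mem F u -> real_mem F (fun x => a * u x + b).
Proof.
move=> Fu; apply: (real_memD FA); last exact: (real_mem_cst F1).
exact: (real_memZ FA F1).
Qed.

Lemma well_insideC B A : B \inside A -> ~` A \inside ~` B.
Proof.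
move=> [u Fu [u0 u1]]; exists (fun x => -1 * u x + 1).
  exact: real_mem_affine.
split=> x => [/u1|/contrapT/u0]; lra.
Qed.

(** The intermediate set is a sublevel set of u at height 1/2; rescaling each
    half of the range of u gives the two witnesses. *)
Lemma well_inside_interp B A : B \inside A -> exists2 C, B \inside C & C \inside A.
Proof.
move=> [u Fu [u0 u1]]; exists [set x | u x <= 1 / 2].
  exists (fun x => 2 * u x + 0); first exact: real_mem_affine.
  by split=> x => [/u0|/negP]; [|rewrite -ltNge]; lra.
exists (fun x => 2 * u x + -1); first exact: real_mem_affine.
by split=> x => [/=|/u1]; lra.
Qed.

Lemma real_mem_max u v : real_mem F u -> real_mem F v ->
  real_mem F (fun x => Num.max (u x) (v x)).
Proof.
move=> Fu Fv; have Fuv := real_memD FA Fu (real_mem_affine (-1) 0 Fv).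
have := real_mem_affine 2^-1 0 (real_memD FA (real_memD FA Fu Fv)
  (real_mem_abs FA F1 Fuv)).
congr (real_mem _ _); apply/funext => x; rewrite mulN1r !addr0.
by rewrite maxr_absE mulrC.
Qed.

(** The function is the truncation of a witness to the unit interval. *)
Lemma well_inside_function B A : B \inside A -> exists2 h : X -> R, real_mem F h &
  [/\ forall x, 0 <= h x <= 1, forall x, B x -> h x = 0 &
      forall x, ~ A x -> h x = 1].
Proof.
move=> [u Fu [u0 u1]].
have Fw : real_mem F (fun x => -1 * Num.max (u x) 0 + 1).
  by apply: real_mem_affine; apply: real_mem_max => //; exact: (real_mem_cst F1).
have Fh := real_mem_affine (-1) 1 (real_mem_max Fw (real_mem_cst F1 0)).
eexists; first exact: Fh.
have hE x : let h := -1 * Num.max (-1 * Num.max (u x) 0 + 1) 0 + 1 in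
    [/\ 0 <= h <= 1, u x <= 0 -> h = 0 & 1 <= u x -> h = 1].
  move=> /=; case: (leP (u x) 0) => ux; case: (leP (-1 * _ + 1) 0) => ux';
    split=> *; lra.
by split=> x => [|/u0 ux|/u1 ux]; have [? h0 h1] := hE x; [|exact: h0|exact: h1].
Qed.

Lemma well_insideI B A B' A' :
  B \inside A -> B' \inside A' -> B `&` B' \inside A `&` A'.
Proof.
move=> /well_inside_function[u Fu [u01 u0 u1]].
move=> /well_inside_function[v Fv [v01 v0 v1]].
exists (fun x => u x + v x); first exact: (real_memD FA).
split=> x => [[/u0-> /v0->]|/not_andP[/u1 ->|/v1->]]; first by rewrite addr0.
  by have := v01 x; lra.
by have := u01 x; lra.
Qed.

(** An F-function equal to 0 on B and 1 off A may be complex-valued; its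
    squared modulus is a real witness.  Conversely truncation restores the exact
    values, and both are attained as B and the complement of A are nonempty. *)
Lemma FfilterP (p : set_system X) : Ffilter F p <->
  ProperFilter p /\ forall A, p A -> exists2 B, p B & B \inside A.
Proof.
split=> [[pF [_ _ pfam]]|[pF pin]]; split=> //.
  move=> A pA; have [->|AT] := pselect (A = setT).
    by exists setT; [exact: filterT|exact: well_insideT].
  have [B [f [pB Ff fB fA]]] := pfam _ pA AT.
  exists B => //; exists (fun y => Normc.normc (f y - 0) ^+ 2).
    exact: (real_mem_dist FA F1).
  split=> x => [Bx|Ax]; rewrite subr0.
    have -> : f x = 0 by have : [set 0] (f x) by rewrite -fB; exists x.
    by rewrite Normc.normc0 expr0n.
  have -> : f x = 1 by have : [set 1] (f x) by rewrite -fA; exists x.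
  by rewrite Normc.normc1 expr1n.
split; first by exists setT; exact: filterT.
  by move=> A /filter_ex.
move=> A pA AT; have [B pB /well_inside_function[h Fh [_ h0 h1]]] := pin _ pA.
exists B, (fun x => (h x)%:C); split=> //; apply/seteqP; split=> [_ [x /= + <-]|_ ->].
- by move=> /h0 ->.
- by have [x Bx] := filter_ex pB; exists x => //; rewrite h0.
- by move=> /h1 ->.
- have [x Ax] : (~` A) !=set0 by apply/set0P/eqP => /(congr1 setC); rewrite setCK setC0.
  by exists x => //; rewrite h1.
Qed.

(** Adding B itself would destroy roundness; only the sets E in which B is
    well inside are added, and interpolation between B and E keeps the result
    round. *)
Definition adjoin (p : set_system X) (B : set X) : set_system X :=
  [set D | exists P E, [/\ p P, B \inside E & P `&` E `<=` D]].

Lemma adjoin_Ffilter p B : Ffilter F p -> (forall P, p P -> P `&` B !=set0) ->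
  Ffilter F (adjoin p B).
Proof.
move=> /FfilterP[pF pin] pB; apply/FfilterP; split.
  split.
    move=> [P [E [/pB[x [Px Bx]] BE]]]; apply; split; first exact: Px.
    exact: well_inside_sub BE _ Bx.
  split.
  - by exists setT, setT; split=> //; [exact: filterT|exact: well_insideT].
  - move=> D D' [P [E [pP BE PE]]] [P' [E' [pP' BE' PE']]].
    exists (P `&` P'), (E `&` E'); split; first exact: filterI.
      by rewrite -[B]setIid; exact: well_insideI.
    by rewrite setIACA; exact: setISS.
  - move=> D D' DD' [P [E [pP BE PE]]]; exists P, E; split=> //.
    exact: subset_trans DD'.
move=> D [P [E [pP BE PE]]].
have [P' pP' P'P] := pin _ pP; have [E' BE' E'E] := well_inside_interp BE.
exists (P' `&` E'); first by exists P', E'; split.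
by apply: (well_insideS _ PE) (well_insideI P'P E'E).
Qed.

Lemma Fultrafilter_max p q :
  Fultrafilter F p -> Ffilter F q -> p `<=` q -> q `<=` p.
Proof. by move=> [_ pmax] qF pq; apply: contrapT => qp; exact: (pmax q). Qed.

Lemma Fultrafilter_dichotomy p B A :
  Fultrafilter F p -> B \inside A -> p A \/ p (~` B).
Proof.
move=> pU BA; have [pB|pnB] := pselect (p (~` B)); [by right|left].
have [pF _] := pU; have PF := pF.1.
apply: (Fultrafilter_max pU (q := adjoin p B)).
- apply: adjoin_Ffilter => // P pP; apply/set0P/eqP => /disjoints_subset PB.
  by apply: pnB; exact: filterS PB pP.
- move=> P pP; exists P, setT; split=> //; first exact: well_insideT.
- exists setT, A; split=> //; first exact: filterT.
Qed.

Lemma open_hat (A : set X) : open (hat A : set (delta F)).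
Proof. by exists [set A]; [|rewrite bigcup_set1]. Qed.

Lemma nbhs_hat (p : delta F) (N : set (delta F)) :
  nbhs p N -> exists2 A, sval p A & hat A `<=` N.
Proof.
rewrite nbhsE => -[_ [[D _ <-] [A DA pA]] DN].
by exists A => //; apply: subset_trans DN => q qA; exists A.
Qed.

Lemma delta_proper (p : delta F) : ProperFilter (sval p).
Proof. by case: (svalP p) => -[]. Qed.

Lemma delta_round (p : delta F) A :
  sval p A -> exists2 B, sval p B & B \inside A.
Proof. by case: (svalP p) => /FfilterP[_] + _; exact. Qed.

Lemma hausdorff_delta : hausdorff_space (delta F).
Proof.
rewrite open_hausdorff => p q /eqP pq.
have [A [pA qA]] : exists A, sval p A /\ ~ sval q A.
  apply: contrapT => npq; have sub : sval p `<=` sval q.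
    by move=> A pA; apply: contrapT => qA; apply: npq; exists A.
  apply: pq; apply: eq_sig_hprop => [r|]; first exact: Prop_irrelevance.
  apply/seteqP; split=> //.
  exact: (Fultrafilter_max (svalP p) (svalP q).1).
have [B pB BA] := delta_round pA.
have [//|qB] := Fultrafilter_dichotomy (svalP q) BA.
exists (hat B, hat (~` B)); first by rewrite !inE.
split; [exact: open_hat|exact: open_hat|].
rewrite -hatI setICr; apply/eqP/seteqP; split=> // r r0.
by have := @filter_not_empty _ _ (delta_proper r); apply.
Qed.

(** The F-filter to which an ultrafilter on the space converges; the traces
    [U (hat A)] alone form a filter that need not be round. *)
Definition limit_filter (U : set_system (delta F)) : set_system X :=
  [set A | exists2 B, U (hat B) & B \inside A].

Lemma limit_filter_Ffilter U : ProperFilter U -> Ffilter F (limit_filter U).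
Proof.
move=> UF; apply/FfilterP; split.
  split.
    move=> [B /filter_ex[p pB] /well_inside_sub B0].
    have [x /B0 //] := @filter_ex _ _ (delta_proper p) _ pB.
  split.
  - by exists setT; [rewrite hatT; exact: filterT|exact: well_insideT].
  - move=> A A' [B UB BA] [B' UB' BA']; exists (B `&` B').
      by rewrite hatI; exact: filterI.
    exact: well_insideI.
  - move=> A A' AA' [B UB BA]; exists B => //.
    exact: well_insideS AA' BA.
move=> A [B UB /well_inside_interp[C BC CA]].
by exists C => //; exists B.
Qed.

Lemma ultra_hat (U : set_system (delta F)) B A : UltraFilter U -> B \inside A ->
  U (hat A) \/ U (hat (~` B)).
Proof.
move=> UU BA; have [|UA] := in_ultra_setVsetC (hat A) UU; first by left.
right; apply: filterS UA => p nA.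
by have [/nA|] := Fultrafilter_dichotomy (svalP p) BA.
Qed.

(** A set A of a larger F-filter q has some B in q well inside it, with C
    between them.  Either U contains the basic open set of C, and then A is in
    the limit filter, or U contains that of ~` B, which contradicts B in q. *)
Lemma limit_filter_Fultrafilter U :
  UltraFilter U -> Fultrafilter F (limit_filter U).
Proof.
move=> UU; split; first exact: limit_filter_Ffilter.
move=> q /FfilterP[qF qin] [Lq]; apply => A qA.
have [B qB /well_inside_interp[C BC CA]] := qin _ qA.
have [UC|UB] := ultra_hat UU BC; first by exists C.
have [B' qB' B'B] := qin _ qB.
(* B' is in q, and its complement too: it belongs to the limit filter since
   ~` B is well inside it. *)
have qnB' : q (~` B') by apply: Lq; exists (~` B) => //; exact: well_insideC.
by have [x []] := filter_ex (filterI qB' qnB').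
Qed.

Lemma compact_delta : compact [set: delta F].
Proof.
rewrite compact_ultra => U UU _.
exists (exist _ _ (limit_filter_Fultrafilter UU)); split=> // N.
move=> /nbhs_hat[A [B UB BA] AN]; apply: filterS UB => p pB.
by apply: AN; apply: (@filterS _ _ (delta_proper p)) pB; exact: well_inside_sub.
Qed.

Lemma dense_evaluation : dense (range (evaluation FA F1)).
Proof.
move=> O [p Op] Oop.
have [A /delta_round[B pB /well_inside_function[h Fh [h01 h0 h1]]] AO] :=
  nbhs_hat (open_nbhs_nbhs (conj Oop Op)).
have [x Bx] := @filter_ex _ _ (delta_proper p) _ pB.
exists (evaluation FA F1 x); split; last by exists x.
apply: AO; apply/(FnbhsP FA F1); exists h => //; split=> [|y|y /h1->//].
  exact: h0.
by have /andP[] := h01 y.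
Qed.

End proximity.

Theorem theorem18 (R : realType) (X : pointedType) (F : set (X -> R[i]))
    (FA : Cstar_subalgebra F) (F1 : contains_constants F) :
  [/\ compact [set: delta F],
      hausdorff_space (delta F) &
      dense (range (evaluation FA F1))].
Proof.
split; [exact: compact_delta|exact: hausdorff_delta|exact: dense_evaluation].
Qed.
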